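(* Consider the problem $\min_{x\in\mathbb{R}^n}\Phi(x)$, $\Phi(x):=\Psi(x)+\mathcal{X}(x)$, $\Psi=f+h$, where $f$ is differentiable with $L_f$-Lipschitz gradient (possibly nonconvex), $h$ is convex and differentiable with $L_h$-Lipschitz gradient, $L_\Psi=L_f+L_h$, and $\mathcal{X}$ is a proper closed convex (possibly nonsmooth) function with bounded domain. Let $$\mathcal{P}(x,y,c):=\operatorname{argmin}_{u}\Big\{\langle y,u\rangle+\frac{1}{2c}\|u-x\|^2+\mathcal{X}(u)\Big\},\qquad\mathcal{G}(x,y,c):=\frac{1}{c}[x-\mathcal{P}(x,y,c)],$$ and assume there is a constant $M$ with $\|\mathcal{P}(x,y,c)\|\le M$ for all $c>0$, $x,y\in\mathbb{R}^n$. Consider the composite AG method: given $x_0$, $\{\alpha_k\}$ with $\alpha_1=1$, $\alpha_k\in(0,1)$ for $k\ge2$, $\{\beta_k>0\}$, $\{\lambda_k>0\}$, set $x^{ag}_0=x_0$ and for $k\ge1$ $$x^{md}_k=(1-\alpha_k)x^{ag}_{k-1}+\alpha_kx_{k-1},\quad x_k=\mathcal{P}(x_{k-1},\nabla\Psi(x^{md}_k),\lambda_k),\quad x^{ag}_k=\mathcal{P}(x^{md}_k,\nabla\Psi(x^{md}_k),\beta_k).$$ Let $\Gamma_1=1$, $\Gamma_k=(1-\alpha_k)\Gamma_{k-1}$ ($k\ge2$). Suppose $\alpha_k\lambda_k\le\beta_k<1/L_\Psi$ for all $k$, $\frac{\alpha_1}{\lambda_1\Gamma_1}\ge\frac{\alpha_2}{\lambda_2\Gamma_2}\ge\cdots$,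 and that an optimal solution $x^*$ of $\min\Phi$ exists. Then for any $N\ge1$, $$\min_{k=1,\ldots,N}\|\mathcal{G}(x^{md}_k,\nabla\Psi(x^{md}_k),\beta_k)\|^2\le2\Big[\sum_{k=1}^N\Gamma_k^{-1}\beta_k(1-L_\Psi\beta_k)\Big]^{-1}\Big[\frac{\|x_0-x^*\|^2}{2\lambda_1}+\frac{L_f}{\Gamma_N}(\|x^*\|^2+2M^2)\Big].$$ If in addition $L_f=0$, then $\Phi(x^{ag}_N)-\Phi(x^* )\le\frac{\Gamma_N\|x_0-x^*\|^2}{2\lambda_1}$.
   Context: $\|\cdot\|$ is the Euclidean norm. *)

(* Defs.v *)
From HB Require Import structures.
From mathcomp Require Import all_boot all_order all_algebra.
From mathcomp Require Import all_classical all_reals all_analysis.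
Set Implicit Arguments. Unset Strict Implicit. Unset Printing Implicit Defensive.
Import Order.TTheory GRing.Theory Num.Theory.
Import numFieldNormedType.Exports.
Local Open Scope ring_scope.

Section Defs.
Variables (R : realType) (n : nat).
Local Notation vec := 'rV[R]_n.

Definition dotv (u v : vec) : R := \sum_(i < n) u 0 i * v 0 i.
Definition enorm (v : vec) : R := Num.sqrt (dotv v v).

Definition is_gradient (f : vec -> R) (g : vec -> vec) : Prop :=
  forall x, differentiable f x /\ forall v, 'd f x v = dotv (g x) v.

Definition lipschitz_map (L : R) (g : vec -> vec) : Prop :=
  forall x y, enorm (g x - g y) <= L * enorm (x - y).

Definition convex_fun (h : vec -> R) : Prop :=
  forall (x y : vec) (t : R), 0 <= t <= 1 ->
    h (t *: x + (1 - t) *: y) <= t * h x + (1 - t) * h y.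

Definition proper_fun (X : vec -> \bar R) : Prop :=
  (forall x, X x != -oo%E) /\ exists x, X x \is a fin_num.

Definition econvex_fun (X : vec -> \bar R) : Prop :=
  forall (x y : vec) (t : R), 0 < t < 1 ->
    (X (t *: x + (1 - t) *: y)%R <= t%:E * X x + (1 - t)%:E * X y)%E.

Definition closed_fun (X : vec -> \bar R) : Prop := lower_semicontinuous X.

Definition bounded_dom (X : vec -> \bar R) : Prop :=
  exists B : R, forall x, (X x < +oo)%E -> enorm x <= B.

Definition prox_obj (X : vec -> \bar R) (x y : vec) (c : R) (u : vec) : \bar R :=
  ((dotv y u + (2 * c)^-1 * enorm (u - x) ^+ 2)%:E + X u)%E.

(* P is the prox-mapping: P x y c is a minimizer of prox_obj for every c > 0
   (the minimizer exists and is unique, so this determines P on c > 0) *)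
Definition is_prox (X : vec -> \bar R) (P : vec -> vec -> R -> vec) : Prop :=
  forall x y c, 0 < c -> forall u, (prox_obj X x y c (P x y c) <= prox_obj X x y c u)%E.

Definition grad_map (P : vec -> vec -> R -> vec) (x y : vec) (c : R) : vec :=
  c^-1 *: (x - P x y c).

End Defs.

(* Gamma_1 = 1, Gamma_k = (1 - alpha_k) Gamma_{k-1} for k >= 2 (Gamma_0 unused, = 1) *)
Fixpoint Gamma {R : realType} (alpha : nat -> R) (k : nat) : R :=
  match k with
  | 0 => 1
  | 1 => 1
  | k'.+1 => (1 - alpha k) * Gamma alpha k'
  end.

(* Main.v *)
(* Let delta_k = Phi(x^ag_k) - Phi(x^* ). For k >= 2, smoothness, the two prox
   inequalities and convexity of h bound delta_k by
   (1 - alpha_k) delta_(k-1), a telescoping term and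
   alpha_k Lf (|x^*|^2 + M^2), minus
     T_k = (1/beta_k - L)/2 |x^ag_k - x^md_k|^2 + 1/(2 beta_k) |u_k - x^ag_k|^2,
   with u_k = (1 - alpha_k) x^ag_(k-1) + alpha_k x_k.

   The first step is special: x_0 need not lie in the ball of radius M, so the
   curvature error Lf/2 |x_0 - x^*|^2 of the standard argument is not
   controlled. Replacing it by Lf/2 |x^ag_1 - x^*| (|x^ag_1 - x_0| + |x_0 - x^*|)
   suffices unless x_0 is far away and Gamma_N > 1/2. In that case the last
   summand of T_k, usually discarded, is used: as u_k is within 2 M alpha_k of
   x^md_k and the sum of alpha_k / Gamma_k over k >= 2 is 1/Gamma_N - 1 < 1, it
   essentially doubles the weights of the gradient mappings for k >= 2, while
   beta_1 |G_1| = |x^ag_1 - x_0| is then at most |x_0 - x^*| - M. *)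
Require Import Defs.
From HB Require Import structures.
From mathcomp Require Import all_boot all_order all_algebra.
From mathcomp Require Import all_classical all_reals all_analysis.
From mathcomp Require Import ring lra.
Import Order.TTheory GRing.Theory Num.Theory.
Import numFieldNormedType.Exports.
Local Open Scope ring_scope.

Set Implicit Arguments. Unset Strict Implicit.

(** * Euclidean inner product and norm on row vectors *)

Section Euclidean.
Variables (R : realType) (n : nat).
Implicit Types (u v w : 'rV[R]_n) (a : R).

Lemma dotvC u v : dotv u v = dotv v u.
Proof. by apply: eq_bigr => i _; rewrite mulrC. Qed.

Lemma dotvDl u v w : dotv (u + v) w = dotv u w + dotv v w.
Proof. by rewrite -big_split; apply: eq_bigr => i _; rewrite mxE mulrDl. Qed.

Lemma dotvZl a u v : dotv (a *: u) v = a * dotv u v.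
Proof. by rewrite mulr_sumr; apply: eq_bigr => i _; rewrite mxE mulrA. Qed.

Lemma dotvNl u v : dotv (- u) v = - dotv u v.
Proof. by rewrite -scaleN1r dotvZl mulN1r. Qed.

Lemma dotvDr u v w : dotv u (v + w) = dotv u v + dotv u w.
Proof. by rewrite dotvC dotvDl !(dotvC u). Qed.

Lemma dotvZr a u v : dotv u (a *: v) = a * dotv u v.
Proof. by rewrite dotvC dotvZl dotvC. Qed.

Lemma dotvNr u v : dotv u (- v) = - dotv u v.
Proof. by rewrite dotvC dotvNl dotvC. Qed.

Definition dotvE := (dotvDl, dotvDr, dotvNl, dotvNr, dotvZl, dotvZr).

Lemma dotv_ge0 v : 0 <= dotv v v.
Proof. by apply: sumr_ge0 => i _; rewrite -expr2 sqr_ge0. Qed.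

Lemma enorm_ge0 v : 0 <= enorm v.
Proof. exact: sqrtr_ge0. Qed.

Lemma sqr_enorm v : enorm v ^+ 2 = dotv v v.
Proof. by rewrite sqr_sqrtr // dotv_ge0. Qed.

Lemma enorm_eq0 v : enorm v = 0 -> v = 0.
Proof.
move=> v0; have /eqP : dotv v v = 0 by rewrite -sqr_enorm v0 expr0n.
rewrite psumr_eq0 => [/allP v0'|i _]; last by rewrite -expr2 sqr_ge0.
apply/rowP => i; rewrite mxE; apply/eqP.
by have := v0' i (mem_index_enum i); rewrite -expr2 sqrf_eq0.
Qed.

Lemma enormZ a v : enorm (a *: v) = `|a| * enorm v.
Proof.
rewrite /enorm dotvZl dotvZr mulrA -expr2 sqrtrM ?sqr_ge0 //.
by rewrite sqrtr_sqr.
Qed.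

Lemma enorm0 : enorm (0 : 'rV[R]_n) = 0.
Proof. by rewrite -(scale0r 0) enormZ normr0 mul0r. Qed.

Lemma enormN v : enorm (- v) = enorm v.
Proof. by rewrite -scaleN1r enormZ normrN1 mul1r. Qed.

Lemma enormBC u v : enorm (u - v) = enorm (v - u).
Proof. by rewrite -enormN opprB. Qed.

Lemma ler_dotv u v : dotv u v <= enorm u * enorm v.
Proof.
have [uv0|] := eqVneq (enorm u * enorm v) 0.
  rewrite uv0; move/eqP: uv0; rewrite mulf_eq0 => /orP[/eqP/enorm_eq0->|/eqP/enorm_eq0->].
    by rewrite -(scale0r 0) dotvZl mul0r.
  by rewrite -(scale0r 0) dotvZr mul0r.
move=> uvN0; have uv_gt0 : 0 < enorm u * enorm v.
  by rewrite lt0r uvN0 mulr_ge0 // enorm_ge0.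
rewrite -(ler_pM2l uv_gt0).
have := dotv_ge0 (enorm v *: u - enorm u *: v).
rewrite !dotvE (dotvC v u) -!sqr_enorm; nra.
Qed.

Lemma ler_enormD u v : enorm (u + v) <= enorm u + enorm v.
Proof.
rewrite -(@ler_pXn2r _ 2) ?nnegrE ?addr_ge0 ?enorm_ge0 //.
rewrite sqr_enorm !dotvE (dotvC v u) -!sqr_enorm.
have := ler_dotv u v; nra.
Qed.

Lemma ler_enormB u v : enorm (u - v) <= enorm u + enorm v.
Proof. by rewrite -(enormN v) ler_enormD. Qed.

End Euclidean.

(** * First-order bounds from Lipschitz gradients and convexity *)

Section Gradient.
Variables (R : realType) (n : nat).
Implicit Types (f h : 'rV[R]_n -> R) (g : 'rV[R]_n -> 'rV[R]_n) (L : R).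

Lemma is_gradient_line f g (x v : 'rV[R]_n) (s : R) : is_gradient f g ->
  is_derive s 1 (fun r : R => f (x + r *: v)) (dotv (g (x + s *: v)) v).
Proof.
move=> fg; have [df <-] := fg (x + s *: v).
have quotE : (fun t : R => t^-1 *:
    (((fun r : R => f (x + r *: v)) \o shift s) (t *: 1) - f (x + s *: v))) =
    (fun t : R => t^-1 *: ((f \o shift (x + s *: v)) (t *: v) - f (x + s *: v))).
  apply/funext => t /=; congr (_ *: (f _ - _)).
  by rewrite [t *: 1]mulr1 scalerDl addrCA.
apply: DeriveDef; first by rewrite /derivable quotE; exact: diff_derivable.
by rewrite -deriveE // /derive quotE.
Qed.

(** On the segment the gradient differs from [g z] by at most [L] times the interpolation of |x - z|
    and |y - z|, whose mean is half their sum. An endpoint as [z] gives the usual quadratic bounds;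
    the first step of the method needs another [z]. *)
Lemma gradient_bound f g L (x y z : 'rV[R]_n) :
  is_gradient f g -> lipschitz_map L g -> 0 <= L ->
  f y - f x - dotv (g z) (y - x) <=
    L / 2 * enorm (y - x) * (enorm (x - z) + enorm (y - z)).
Proof.
move=> fg gL L0; set v := y - x.
pose A := dotv (g z) v + L * enorm v * enorm (x - z).
pose B := L * enorm v * (enorm (y - z) - enorm (x - z)).
(* [A + B * s] dominates the derivative of [f] along the segment, so [F 1 <= F 0] by the mean value
   theorem. *)
pose F (s : R) := f (x + s *: v) - (A * s + B / 2 * (s * s)).
have dF (s : R) : is_derive s 1 F (dotv (g (x + s *: v)) v - (A + B * s)).
  have df := is_gradient_line x v s fg.
  rewrite /F; apply: is_derive_eq.
  by rewrite /GRing.scale /=; lra.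
have [|c] := @MVT _ F _ 0 1 ltr01 (fun s _ => dF s).
  apply/continuous_subspaceT => s.
  by apply/differentiable_continuous/derivable1_diffP; case: (dF s).
rewrite in_itv /= => /andP[c0 c1]; rewrite subr0 mulr1 => F01.
have : dotv (g (x + c *: v)) v - (A + B * c) <= 0.
  have : dotv (g (x + c *: v) - g z) v <=
      L * enorm v * ((1 - c) * enorm (x - z) + c * enorm (y - z)).
    apply: le_trans (ler_dotv _ _) _.
    rewrite mulrAC; apply: ler_wpM2r (enorm_ge0 _) _ _ _.
    apply: le_trans (gL _ _) _; apply: ler_wpM2l => //.
    have -> : x + c *: v - z = (1 - c) *: (x - z) + c *: (y - z).
      by apply/rowP => i; rewrite !mxE; ring.
    by apply: le_trans (ler_enormD _ _) _; rewrite !enormZ !ger0_norm //; lra.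
  rewrite dotvDl dotvNl /A /B; lra.
rewrite -F01 /F scale1r scale0r addr0 /A /B /v (addrC x) subrK; lra.
Qed.

Lemma gradient_upper f g L (x y : 'rV[R]_n) :
  is_gradient f g -> lipschitz_map L g -> 0 <= L ->
  f y <= f x + dotv (g x) (y - x) + L / 2 * enorm (y - x) ^+ 2.
Proof.
move=> fg gL L0; have := gradient_bound x y x fg gL L0.
rewrite subrr enorm0 expr2; lra.
Qed.

Lemma gradient_lower f g L (x y : 'rV[R]_n) :
  is_gradient f g -> lipschitz_map L g -> 0 <= L ->
  f x + dotv (g x) (y - x) <= f y + L / 2 * enorm (y - x) ^+ 2.
Proof.
move=> fg gL L0; have := gradient_bound y x x fg gL L0.
rewrite subrr enorm0.
by rewrite -(opprB y) enormN dotvNr expr2; lra.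
Qed.

(** Stands in for the limit s -> 0: the choice s = e / (1 + |k| + e) makes s k <= e. *)
Lemma ler_vanish (a b k : R) :
  (forall s, 0 < s < 1 -> a <= b + s * k) -> a <= b.
Proof.
move=> ab; apply/ler_addgt0Pr => e e0.
have k0 : 0 < 1 + `|k| + e by have := normr_ge0 k; lra.
have s01 : 0 < e / (1 + `|k| + e) < 1.
  by rewrite divr_gt0 //= ltr_pdivrMr //; have := normr_ge0 k; lra.
apply: le_trans (ab _ s01) _; rewrite lerD2l mulrAC ler_pdivrMr // ler_pM2l //.
by have := ler_norm k; lra.
Qed.

(** Convexity against the quadratic lower bound leaves an error of order s^2, which vanishes after
    division by s. *)
Lemma convex_gradient h g L (x y : 'rV[R]_n) :
  convex_fun h -> is_gradient h g -> lipschitz_map L g -> 0 <= L ->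
  h x + dotv (g x) (y - x) <= h y.
Proof.
move=> hc hg gL L0.
apply: (ler_vanish (k := L / 2 * enorm (y - x) ^+ 2)) => s /andP[s0 s1].
have s01 : 0 <= s <= 1 by lra.
have := hc y x s s01.
have := gradient_lower x (x + s *: (y - x)) hg gL L0.
have -> : x + s *: (y - x) = s *: y + (1 - s) *: x.
  by apply/rowP => i; rewrite !mxE; ring.
have -> : s *: y + (1 - s) *: x - x = s *: (y - x).
  by apply/rowP => i; rewrite !mxE; ring.
rewrite enormZ dotvZr gtr0_norm // exprMn => low up.
by rewrite -(ler_pM2l s0); lra.
Qed.
End Gradient.

(** * The prox-mapping and its three-point inequality *)

Section Prox.
Variables (R : realType) (n : nat) (X : 'rV[R]_n -> \bar R).
Hypotheses (Xp : proper_fun X) (Xc : econvex_fun X).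

Lemma econvex_fin (x y : 'rV[R]_n) (t : R) : 0 < t < 1 ->
  X x \is a fin_num -> X y \is a fin_num ->
  X (t *: x + (1 - t) *: y) \is a fin_num /\
  fine (X (t *: x + (1 - t) *: y)) <= t * fine (X x) + (1 - t) * fine (X y).
Proof.
move=> t01 fx fy; have := Xc x y t01.
rewrite -(fineK fx) -(fineK fy) -!EFinM -EFinD => le.
have fz : X (t *: x + (1 - t) *: y) \is a fin_num.
  rewrite fin_numE (proj1 Xp _) /=.
  by apply/eqP => E; move: le; rewrite E.
by split => //; move: le; rewrite -(fineK fz) lee_fin.
Qed.

Variable P : 'rV[R]_n -> 'rV[R]_n -> R -> 'rV[R]_n.
Hypothesis Pp : is_prox X P.

Lemma prox_fin x y c : 0 < c -> X (P x y c) \is a fin_num.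
Proof.
move=> c0; have [u fu] := proj2 Xp; have := Pp x y c0 u.
rewrite /prox_obj -(fineK fu) -EFinD fin_numE (proj1 Xp _) /= => le.
by apply/eqP => E; move: le; rewrite E addey.
Qed.

(** Minimality of p is tested at s u + (1 - s) p. The squared distance to x has the exact convexity
    defect s (1 - s) |u - p|^2 there, so dividing by s and letting s -> 0 leaves the term in |u -
    p|^2. *)
Lemma prox_three_points x y c u : 0 < c -> X u \is a fin_num ->
  dotv y (P x y c - u) + fine (X (P x y c)) - fine (X u) <=
  (2 * c)^-1 * (enorm (u - x) ^+ 2 - enorm (P x y c - x) ^+ 2
                - enorm (u - P x y c) ^+ 2).
Proof.
move=> c0 fu; have fp := prox_fin x y c0; set p := P x y c in fp *.
rewrite -subr_ge0.
apply: (ler_vanish (k := (2 * c)^-1 * enorm (u - p) ^+ 2)) => s s01.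
have [fz le] := econvex_fin s01 fu fp.
have := Pp x y c0 (s *: u + (1 - s) *: p); rewrite -/p /prox_obj.
rewrite -(fineK fz) -(fineK fp) -!EFinD lee_fin.
have s0 : 0 < s by lra.
rewrite -(pmulr_rge0 _ s0) => le2.
have E : enorm (s *: u + (1 - s) *: p - x) ^+ 2 = s * enorm (u - x) ^+ 2
   + (1 - s) * enorm (p - x) ^+ 2 - s * (1 - s) * enorm (u - p) ^+ 2.
  by rewrite !sqr_enorm !dotvE (dotvC p u) (dotvC x u) (dotvC x p); ring.
move: le2; rewrite E !dotvE; nra.
Qed.
End Prox.

(** * Inequalities for a single iteration *)

Section Step.
Variables (R : realType) (n : nat).
Variables (f h : 'rV[R]_n -> R) (gf gh : 'rV[R]_n -> 'rV[R]_n).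
Variables (X : 'rV[R]_n -> \bar R) (P : 'rV[R]_n -> 'rV[R]_n -> R -> 'rV[R]_n).
Variables (Lf Lh M : R) (xstar : 'rV[R]_n).
Hypotheses (fg : is_gradient f gf) (Lf0 : 0 <= Lf) (gfL : lipschitz_map Lf gf).
Hypotheses (hc : convex_fun h) (hg : is_gradient h gh) (Lh0 : 0 <= Lh).
Hypotheses (ghL : lipschitz_map Lh gh).
Hypotheses (Xp : proper_fun X) (Xc : econvex_fun X) (Pp : is_prox X P).
Hypothesis xstar_opt : forall x,
  (((f xstar + h xstar)%:E + X xstar) <= ((f x + h x)%:E + X x))%E.

(** [fine] sends infinite values to 0, so this is the objective only where [X] is finite. *)
Definition composite x : R := f x + h x + fine (X x).

Lemma optimal_fin : X xstar \is a fin_num.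
Proof.
have [u fu] := proj2 Xp; have := xstar_opt u.
rewrite -(fineK fu) -EFinD fin_numE (proj1 Xp _) /= => le.
by apply/eqP => E; move: le; rewrite E addey.
Qed.

Lemma optimal_composite x : X x \is a fin_num -> composite xstar <= composite x.
Proof.
move=> fx; have := xstar_opt x.
by rewrite -(fineK fx) -(fineK optimal_fin) -!EFinD lee_fin.
Qed.

(** Optimality, the descent bounds and the prox inequality at [xstar] give (1/c - (Lf + Lh)/2) |p -
    xstar|^2 <= 0. This makes a uniform bound on [P] apply to [xstar]. *)
Lemma prox_optimal c : 0 < c -> (Lf + Lh) * c < 1 ->
  P xstar (gf xstar + gh xstar) c = xstar.
Proof.
move=> c0 Lc; set p := P _ _ _.
have fs := optimal_fin; have fp : X p \is a fin_num := prox_fin Xp Pp _ _ c0.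
have opt := optimal_composite fp; rewrite /composite in opt.
have px := prox_three_points Xp Xc Pp xstar (gf xstar + gh xstar) c0 fs.
rewrite -/p in px.
have uf := gradient_upper xstar p fg gfL Lf0.
have uh := gradient_upper xstar p hg ghL Lh0.
rewrite subrr enorm0 (enormBC xstar) invfM expr0n /= in px.
have icL : (Lf + Lh) < c^-1 by rewrite -div1r ltr_pdivlMr.
have le0 : (c^-1 - (Lf + Lh)) * enorm (p - xstar) ^+ 2 <= 0.
  have : 0 <= c^-1 * enorm (p - xstar) ^+ 2.
    by rewrite mulr_ge0 ?sqr_ge0 // invr_ge0 ltW.
  by move: px; rewrite !dotvE in uf uh *; lra.
apply/eqP; rewrite -subr_eq0; apply/eqP/enorm_eq0/eqP.
rewrite -sqrf_eq0 eq_le sqr_ge0 andbT.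
by rewrite -(pmulr_rle0 _ (_ : 0 < c^-1 - (Lf + Lh))) // subr_gt0.
Qed.

(* The error term in Lf keeps |x0 - xstar| only to the first power. *)
Lemma first_step (x0 g p x1 : 'rV[R]_n) (b l : R) :
  g = gf x0 + gh x0 -> p = P x0 g b -> x1 = P x0 g l -> 0 < l -> l <= b ->
  composite p - composite xstar + (b^-1 - (Lf + Lh)) / 2 * enorm (p - x0) ^+ 2
    + l^-1 / 2 * enorm (x1 - xstar) ^+ 2
  <= l^-1 / 2 * enorm (x0 - xstar) ^+ 2
    + Lf / 2 * (enorm (p - xstar) * (enorm (p - x0) + enorm (x0 - xstar))
                - enorm (p - x0) ^+ 2).
Proof.
move=> gE pE xE l0 lb; have b0 := lt_le_trans l0 lb.
have f1 : X x1 \is a fin_num by rewrite xE (prox_fin Xp Pp).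
(* [f] is compared directly between [xstar] and [p], with the gradient taken at [x0]; [h] is
   compared through [x0]. *)
have uf := gradient_bound xstar p x0 fg gfL Lf0.
have uh := gradient_upper x0 p hg ghL Lh0.
have lh := convex_gradient x0 xstar hc hg ghL Lh0.
(* Testing [p] at [x1] and [x1] at [xstar] chains the values of [X]; [l <= b] then absorbs |x1 -
   x0|^2. *)
have p1 := prox_three_points Xp Xc Pp x0 g b0 f1; rewrite -pE in p1.
have p2 := prox_three_points Xp Xc Pp x0 g l0 optimal_fin; rewrite -xE in p2.
have w1 : 0 <= b^-1 * enorm (x1 - p) ^+ 2.
  by rewrite mulr_ge0 ?sqr_ge0 // invr_ge0 ltW.
have w2 : b^-1 * enorm (x1 - x0) ^+ 2 <= l^-1 * enorm (x1 - x0) ^+ 2.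
  by rewrite ler_wpM2r ?sqr_ge0 // lef_pV2.
rewrite !invfM (enormBC xstar) in uf p1 p2; rewrite (enormBC xstar) in p2.
rewrite /composite; move: p1 p2; rewrite gE !dotvE in uf uh lh *; lra.
Qed.

(** The prox inequality of [p] is tested at the combination [u], that of [x1] at [xstar] with weight
    [a]. Linear bounds at [xm] are applied to [xa] and [xstar] with weights 1 - a and a;
    nonconvexity of [f] costs the curvature estimated in [curv]. *)
Lemma later_step (xa xp xm g p x1 : 'rV[R]_n) (a b l : R) :
  xm = (1 - a) *: xa + a *: xp -> g = gf xm + gh xm ->
  p = P xm g b -> x1 = P xp g l ->
  0 < a < 1 -> 0 < l -> 0 < b -> a * l <= b ->
  X xa \is a fin_num -> enorm xa <= M -> enorm xp <= M ->
  composite p - composite xstar + (b^-1 - (Lf + Lh)) / 2 * enorm (p - xm) ^+ 2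
    + b^-1 / 2 * enorm ((1 - a) *: xa + a *: x1 - p) ^+ 2
  <= (1 - a) * (composite xa - composite xstar)
    + a * (l^-1 / 2) * (enorm (xp - xstar) ^+ 2 - enorm (x1 - xstar) ^+ 2)
    + a * (Lf * (enorm xstar ^+ 2 + M ^+ 2)).
Proof.
move=> mE gE pE xE a01 l0 b0 alb fa xaM xpM.
set u := (1 - a) *: xa + a *: x1.
have f1 : X x1 \is a fin_num by rewrite xE (prox_fin Xp Pp).
have [fu Xu] : X u \is a fin_num /\
    fine (X u) <= a * fine (X x1) + (1 - a) * fine (X xa).
  by rewrite /u addrC; exact: econvex_fin.
have uf := gradient_upper xm p fg gfL Lf0.
have uh := gradient_upper xm p hg ghL Lh0.
have lfa := gradient_lower xm xa fg gfL Lf0.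
have lfs := gradient_lower xm xstar fg gfL Lf0.
have lha := convex_gradient xm xa hc hg ghL Lh0.
have lhs := convex_gradient xm xstar hc hg ghL Lh0.
have p1 := prox_three_points Xp Xc Pp xm g b0 fu; rewrite -pE in p1.
have p2 := prox_three_points Xp Xc Pp xp g l0 optimal_fin; rewrite -xE in p2.
have [a0 a1] : 0 < a /\ 0 < 1 - a by lra.
rewrite -(ler_pM2l a1) in lfa; rewrite -(ler_pM2l a1) in lha.
rewrite -(ler_pM2l a0) in lfs; rewrite -(ler_pM2l a0) in lhs.
rewrite -(ler_pM2l a0) in p2.
have dE : enorm (u - xm) ^+ 2 = a ^+ 2 * enorm (x1 - xp) ^+ 2.
  have -> : u - xm = a *: (x1 - xp).
    by rewrite mE; apply/rowP => i; rewrite !mxE; ring.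
  by rewrite enormZ exprMn gtr0_norm.
(* As [a * l <= b], the negative term of [p2] absorbs the term |u - xm|^2 of [p1]. *)
have w2 : b^-1 * (a ^+ 2 * enorm (x1 - xp) ^+ 2)
    <= a * l^-1 * enorm (x1 - xp) ^+ 2.
  rewrite mulrA ler_wpM2r ?sqr_ge0 // mulrC ler_pdivrMr //.
  by rewrite mulrAC ler_pdivlMr // expr2 -mulrA ler_pM2l.
(* Parallelogram law for [xstar] and [xm]; expanding |xm|^2 as a weighted mean leaves a nonpositive
   multiple of |xa - xp|^2. *)
have curv : a * enorm (xstar - xm) ^+ 2 + (1 - a) * enorm (xa - xm) ^+ 2
    <= a * (2 * enorm xstar ^+ 2 + 2 * M ^+ 2).
  have -> : a * enorm (xstar - xm) ^+ 2 + (1 - a) * enorm (xa - xm) ^+ 2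
      = a * (2 * enorm xstar ^+ 2
        + 2 * ((1 - a) * enorm xa ^+ 2 + a * enorm xp ^+ 2)
        - enorm (xstar + xm) ^+ 2 - a * (1 - a) * enorm (xa - xp) ^+ 2).
    rewrite mE !sqr_enorm !dotvE (dotvC xp xa) (dotvC xa xstar) (dotvC xp xstar).
    ring.
  have sqM (x : 'rV[R]_n) : enorm x <= M -> enorm x ^+ 2 <= M ^+ 2.
    by move=> xM; rewrite lerXn2r ?nnegrE ?enorm_ge0 // (le_trans (enorm_ge0 x)).
  have := sqM _ xaM; have := sqM _ xpM.
  rewrite ler_pM2l //; have := sqr_ge0 (enorm (xstar + xm)).
  have : 0 <= a * (1 - a) * enorm (xa - xp) ^+ 2.
    by apply: mulr_ge0 (sqr_ge0 _); apply: mulr_ge0; apply: ltW.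
  nra.
have curvL : Lf * (a * enorm (xstar - xm) ^+ 2 + (1 - a) * enorm (xa - xm) ^+ 2)
    <= Lf * (a * (2 * enorm xstar ^+ 2 + 2 * M ^+ 2)) by apply: ler_wpM2l.
have gu v : dotv v u = (1 - a) * dotv v xa + a * dotv v x1 by rewrite !dotvE.
have gm v : dotv v xm = (1 - a) * dotv v xa + a * dotv v xp by rewrite mE !dotvE.
clearbody u.
rewrite !invfM in p1 p2; rewrite (enormBC xstar xp) (enormBC xstar x1) in p2.
rewrite dE in p1.
rewrite /composite; move: p1 p2.
rewrite gE !(dotvDl, dotvDr, dotvNr) in uf uh lfa lfs lha lhs *.
rewrite !gm in uf uh lfa lfs lha lhs; rewrite !gu ?gm; lra.
Qed.
End Step.

(** * Scalar inequalities: weights, telescoping, final combination *)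

Section Scalar.
Variable R : realType.

(** Here e = |x^ag_k - x^md_k|, w = |u_k - x^ag_k|, s bounds |u_k - x^md_k| and mu is the least
    gradient-mapping norm. The first bound discards w; the second uses w >= b mu - s to double the
    weight at a cost linear in mu. *)
Lemma waste_bound (b L e w s mu : R) :
  0 < b -> 0 <= L -> L * b < 1 -> 0 <= mu -> b * mu <= e -> 0 <= s ->
  e <= w + s ->
  b * (1 - L * b) * mu ^+ 2 / 2 <= (b^-1 - L) / 2 * e ^+ 2 + b^-1 / 2 * w ^+ 2
  /\
  b * (1 - L * b) * mu ^+ 2 - s * mu
    <= (b^-1 - L) / 2 * e ^+ 2 + b^-1 / 2 * w ^+ 2.
Proof.
move=> b0 L0 Lb mu0 bmu s0 ews.
have i0 : 0 < b^-1 by rewrite invr_gt0.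
have iL : b^-1 - L = b^-1 * (1 - L * b).
  by rewrite mulrBr mulr1 mulrCA mulVf ?mulr1 ?gt_eqF.
have bb : b^-1 * b = 1 by rewrite mulVf ?gt_eqF.
have eb : b * (1 - L * b) * mu ^+ 2 <= (b^-1 - L) * e ^+ 2.
  have -> : b * (1 - L * b) * mu ^+ 2 = (b^-1 - L) * (b * mu) ^+ 2.
    rewrite iL exprMn expr2.
    by rewrite [RHS](_ : _ = (b^-1 * b) * (b * (1 - L * b) * mu ^+ 2));
      [rewrite bb mul1r | ring].
  have bmu0 : 0 <= b * mu by apply: mulr_ge0 => //; exact: ltW.
  have e0 := le_trans bmu0 bmu.
  rewrite ler_wpM2l ?lerXn2r ?nnegrE // iL.
  by apply: mulr_ge0; [exact: ltW | lra].
have w0 : 0 <= b^-1 * w ^+ 2 by rewrite mulr_ge0 ?sqr_ge0 // ltW.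
split; first lra.
have bmu2 : 0 <= b * (L * b) * mu ^+ 2.
  by rewrite !mulr_ge0 ?sqr_ge0 // ltW.
(* Half of the weight comes from [eb]; in the other half [bmu2] allows dropping the factor 1 - L
   b. *)
suff : b * mu ^+ 2 - 2 * s * mu <= b^-1 * w ^+ 2 by lra.
have [bs|sb] := leP (b * mu) s.
  apply: le_trans w0.
  have : b * mu * mu <= s * mu by apply: ler_wpM2r.
  have : 0 <= s * mu by exact: mulr_ge0.
  by rewrite expr2; lra.
have ww : (b * mu - s) ^+ 2 <= w ^+ 2.
  by rewrite lerXn2r ?nnegrE //; lra.
have : b^-1 * (b * mu - s) ^+ 2 <= b^-1 * w ^+ 2 by rewrite ler_pM2l.
have -> : b^-1 * (b * mu - s) ^+ 2 =
   (b^-1 * b) * (b * mu ^+ 2 - 2 * s * mu) + b^-1 * s ^+ 2 by ring.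
have : 0 <= b^-1 * s ^+ 2 by rewrite mulr_ge0 ?sqr_ge0 // ltW.
by rewrite bb; lra.
Qed.

Lemma Gamma_gt0 (alpha : nat -> R) k :
  (forall k, (2 <= k)%N -> 0 < alpha k < 1) -> 0 < Gamma alpha k.
Proof.
move=> al; elim: k => [|[|k] IH] //=; rewrite mulr_gt0 //.
by have := al k.+2 isT; lra.
Qed.

Lemma GammaS (alpha : nat -> R) k :
  Gamma alpha k.+2 = (1 - alpha k.+2) * Gamma alpha k.+1.
Proof. by []. Qed.

(** Each summand equals 1 / Gamma_k - 1 / Gamma_(k-1), and Gamma_1 = 1. *)
Lemma sum_alpha_Gamma (alpha : nat -> R) N :
  (forall k, (2 <= k)%N -> 0 < alpha k < 1) ->
  \sum_(2 <= k < N.+2) alpha k / Gamma alpha k = (Gamma alpha N.+1)^-1 - 1.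
Proof.
move=> al; elim: N => [|N IH]; first by rewrite big_geq //= invr1 subrr.
rewrite big_nat_recr //= IH -/(Gamma alpha N.+1).
have G0 := Gamma_gt0 N.+1 al; have a2 := al N.+2 isT.
have a1 : 1 - alpha N.+2 != 0 by rewrite gt_eqF //; lra.
by field; rewrite a1 gt_eqF.
Qed.

(** Divide each step by [Gamma]; the coefficients of [rho] are then nonincreasing, so its terms
    telescope. [tau] is left free to allow several lower bounds on T_k. *)
Lemma telescope_bound (alpha lambda delta rho tau : nat -> R) (K : R) N :
  alpha 1%N = 1 -> (forall k, (2 <= k)%N -> 0 < alpha k < 1) ->
  (forall k, (1 <= k)%N -> 0 < lambda k) ->
  (forall k, (1 <= k)%N ->
     alpha k.+1 / (lambda k.+1 * Gamma alpha k.+1)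
       <= alpha k / (lambda k * Gamma alpha k)) ->
  (forall k, 0 <= rho k) ->
  (forall k, (1 <= k <= N)%N ->
     delta k.+1 + Gamma alpha k.+1 * tau k.+1
       <= (1 - alpha k.+1) * delta k
          + alpha k.+1 * ((lambda k.+1)^-1 / 2) * (rho k - rho k.+1)
          + alpha k.+1 * K) ->
  delta N.+1 / Gamma alpha N.+1 + \sum_(2 <= k < N.+2) tau k
    <= delta 1%N + (lambda 1%N)^-1 / 2 * rho 1%N
       + K * ((Gamma alpha N.+1)^-1 - 1).
Proof.
move=> a1 al la cd rho0 step.
pose c k := alpha k / (lambda k * Gamma alpha k) / 2.
have c0 k : 0 <= c k.+1.
  apply: divr_ge0 => //; apply: divr_ge0.
    by case: k => [|k]; [rewrite a1 | case/andP: (al k.+2 isT) => /ltW].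
  by rewrite ltW // mulr_gt0 ?la ?Gamma_gt0.
(* The induction has to retain the last [rho] term. *)
suff : delta N.+1 / Gamma alpha N.+1 + c N.+1 * rho N.+1
    + \sum_(2 <= k < N.+2) tau k
    <= delta 1%N + (lambda 1%N)^-1 / 2 * rho 1%N
       + K * ((Gamma alpha N.+1)^-1 - 1).
  by have := mulr_ge0 (c0 N) (rho0 N.+1); lra.
elim: N step => [_|N IH step].
  by rewrite big_geq // /c /= a1 invr1 !mulr1 div1r subrr mulr0 !addr0.
have {}IH : delta N.+1 / Gamma alpha N.+1 + c N.+1 * rho N.+1
    + \sum_(2 <= k < N.+2) tau k
    <= delta 1%N + (lambda 1%N)^-1 / 2 * rho 1%N
       + K * ((Gamma alpha N.+1)^-1 - 1).
  by apply: IH => k /andP[k1 kN]; apply: step; rewrite k1 leqW.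
rewrite big_nat_recr //=.
have G0 := Gamma_gt0 N.+1 al; have G20 := Gamma_gt0 N.+2 al.
have a2 : 1 - alpha N.+2 != 0 by rewrite gt_eqF //; have := al N.+2 isT; lra.
have l2 : lambda N.+2 != 0 by rewrite gt_eqF // la.
have GS : (Gamma alpha N.+2)^-1 * (1 - alpha N.+2) = (Gamma alpha N.+1)^-1.
  by rewrite GammaS; field; rewrite a2 gt_eqF.
have cr : c N.+2 * rho N.+1 <= c N.+1 * rho N.+1.
  by rewrite ler_wpM2r // /c ler_pM2r ?invr_gt0 // cd.
have := step N.+1 (leqnn _); rewrite -(ler_pM2l (_ : 0 < (Gamma alpha N.+2)^-1)) ?invr_gt0 //.
have -> : (Gamma alpha N.+2)^-1 * (delta N.+2 + Gamma alpha N.+2 * tau N.+2)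
   = delta N.+2 / Gamma alpha N.+2 + tau N.+2.
  by field; rewrite gt_eqF.
have -> : (Gamma alpha N.+2)^-1 * ((1 - alpha N.+2) * delta N.+1
    + alpha N.+2 * ((lambda N.+2)^-1 / 2) * (rho N.+1 - rho N.+2)
    + alpha N.+2 * K)
  = (Gamma alpha N.+2)^-1 * (1 - alpha N.+2) * delta N.+1
    + c N.+2 * (rho N.+1 - rho N.+2)
    + ((Gamma alpha N.+2)^-1 - (Gamma alpha N.+2)^-1 * (1 - alpha N.+2)) * K.
  by rewrite /c; field; rewrite l2 gt_eqF.
by rewrite -/(Gamma alpha N.+2) GS; lra.
Qed.

(* Affine in phi, hence checked at phi = 0 and phi = 1. *)
Lemma far_start (M q p a b t phi : R) :
  0 <= M -> 0 <= q -> q <= M -> 0 <= p -> p <= q + M -> 0 <= a -> 0 <= b ->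
  1 <= t -> t <= 2 -> 0 <= phi -> phi <= 1 ->
  0 < p * (a + b) - a ^+ 2 - 2 * (q ^+ 2 + M ^+ 2 + M ^+ 2 * t) ->
  (1 - phi) * a ^+ 2
    + phi * (p * (a + b) - a ^+ 2 - 2 * (q ^+ 2 + M ^+ 2 + M ^+ 2 * t))
    + 4 * M * a * (t - 1)
  <= b ^+ 2 + 2 * phi * t * (q ^+ 2 + 2 * M ^+ 2).
Proof.
move=> M0 q0 qM p0 pqM a0 b0 t1 t2 f0 f1 far.
have p2 : p ^+ 2 <= 2 * q ^+ 2 + 2 * M ^+ 2.
  by have := sqr_ge0 (q - M); nra.
have p2M : p <= 2 * M by lra.
have Mt : 0 <= M ^+ 2 * t by rewrite mulr_ge0 ?sqr_ge0 //; lra.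
(* From 2 p a - a^2 <= p^2 <= 2 q^2 + 2 M^2; with p <= 2 M it yields [baM]. *)
have pab : 2 * (M ^+ 2 * t) < p * (b - a) by have := sqr_ge0 (a - p); nra.
have ba : 0 <= b - a by rewrite leNgt; apply/negP => ?; nra.
have M1 : 0 < M by rewrite lt0r M0 andbT; apply/eqP => E; nra.
have baM : M * t <= b - a.
  rewrite -(ler_pM2l M1).
  have : p * (b - a) <= 2 * M * (b - a) by apply: ler_wpM2r.
  by rewrite expr2 in pab; lra.
(* Case phi = 0: here t <= 2 enters as 2 t >= 4 (t - 1). *)
have end0 : 4 * M * a * (t - 1) <= b ^+ 2 - a ^+ 2.
  have Ma : 0 <= M * a * (2 - t) by rewrite !mulr_ge0 //; lra.
  have : M * t * (2 * a + M * t) <= (b - a) * (b + a).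
    by apply: ler_pM => //; [nra|nra|lra].
  by have := sqr_ge0 (M * t); nra.
(* Case phi = 1: complete the squares in b and in a, then use p <= 2 M and t <= 2. *)
have end1 : p * (a + b) - a ^+ 2 - 2 * (q ^+ 2 + M ^+ 2 + M ^+ 2 * t)
    + 4 * M * a * (t - 1) <= b ^+ 2 + 2 * t * (q ^+ 2 + 2 * M ^+ 2).
  have sb := sqr_ge0 (b - p / 2).
  have sa := sqr_ge0 (a - (p + 4 * M * (t - 1)) / 2).
  have tq : 0 <= t * q ^+ 2 by rewrite mulr_ge0 ?sqr_ge0 //; lra.
  have pM : p ^+ 2 <= 4 * M ^+ 2 by nra.
  have pMt : p * (M * (t - 1)) <= 2 * M * (M * (t - 1)).
    by apply: ler_wpM2r => //; apply: mulr_ge0 => //; lra.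
  have tt : 0 <= M ^+ 2 * (t * (2 - t)) by rewrite !mulr_ge0 ?sqr_ge0 //; lra.
  have q20 := sqr_ge0 q; nra.
have e0 : 0 <= (1 - phi) * (b ^+ 2 - a ^+ 2 - 4 * M * a * (t - 1)).
  by rewrite mulr_ge0 //; lra.
have e1 : 0 <= phi * (b ^+ 2 + 2 * t * (q ^+ 2 + 2 * M ^+ 2) - (p * (a + b)
    - a ^+ 2 - 2 * (q ^+ 2 + M ^+ 2 + M ^+ 2 * t) + 4 * M * a * (t - 1))).
  by rewrite mulr_ge0 //; lra.
lra.
Qed.

(* a, b, p stand for |x^ag_1 - x_0|, |x_0 - x^*|, |x^ag_1 - x^*|; t = 1 / Gamma_N,
   mu is the least norm of the gradient mappings and W the sum of their weights
   for k >= 2. *)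
Lemma combine_bounds (F L be l M q p a b t mu W B : R) :
  0 <= F -> F <= L -> 0 < l -> l <= be -> L * be < 1 ->
  0 <= q -> q <= M -> 0 <= p -> p <= q + M -> 0 <= a -> 0 <= b -> b <= a + p ->
  1 <= t -> 0 <= mu -> be * mu <= a ->
  W * mu ^+ 2 / 2 <= B -> W * mu ^+ 2 - 2 * M * mu * (t - 1) <= B ->
  B + (be^-1 - L) / 2 * a ^+ 2 <= l^-1 / 2 * b ^+ 2
    + F / 2 * (p * (a + b) - a ^+ 2) + F * (q ^+ 2 + M ^+ 2) * (t - 1) ->
  (W + be * (1 - L * be)) * mu ^+ 2 / 2
    <= l^-1 / 2 * b ^+ 2 + F * t * (q ^+ 2 + 2 * M ^+ 2).
Proof.
move=> F0 FL l0 lbe Lbe q0 qM p0 pqM a0 b0 bap t1 mu0 bmu B1 B2 Bu.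
have be0 := lt_le_trans l0 lbe; have M0 := le_trans q0 qM.
have L0 := le_trans F0 FL.
have a0a : a <= 0 + a by rewrite add0r.
have [wa _] := waste_bound be0 L0 Lbe mu0 bmu a0 a0a.
(* [F * D / 2] is the excess of the available bound over the target; for D <= 0 the half weights of
   [B1] suffice. *)
pose D := p * (a + b) - a ^+ 2 - 2 * (q ^+ 2 + M ^+ 2 + M ^+ 2 * t).
have RE : l^-1 / 2 * b ^+ 2 + F / 2 * (p * (a + b) - a ^+ 2)
    + F * (q ^+ 2 + M ^+ 2) * (t - 1)
  = l^-1 / 2 * b ^+ 2 + F * t * (q ^+ 2 + 2 * M ^+ 2) + F * D / 2.
  by rewrite /D; lra.
rewrite RE in Bu.
have [D0|D0] := leP D 0.
  have FD : F * D <= 0 by rewrite mulr_ge0_le0.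
  by lra.
(* b <= a + p and p <= q + M give D <= 4 q M - 2 M^2 t, which rules out t > 2. *)
have t2 : t <= 2.
  rewrite leNgt; apply/negP => t2.
  have : p * (a + b) <= p * (a + (a + p)) by apply: ler_wpM2l => //; lra.
  have : M ^+ 2 * 2 <= M ^+ 2 * t by apply: ler_wpM2l; rewrite ?sqr_ge0 ?ltW.
  have : p ^+ 2 <= (q + M) ^+ 2 by rewrite lerXn2r ?nnegrE ?addr_ge0.
  have : q ^+ 2 <= M ^+ 2 by rewrite lerXn2r ?nnegrE.
  have := sqr_ge0 (a - p); have := sqr_ge0 (q - M).
  by rewrite /D in D0; nra.
have FL' : F * be <= L * be by apply: ler_wpM2r => //; exact: ltW.
have f0 : 0 <= F * be by rewrite mulr_ge0 // ltW.
have f1 : F * be <= 1 by lra.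
have key := far_start M0 q0 qM p0 pqM a0 b0 t1 t2 f0 f1 D0; rewrite -/D in key.
(* If the bound failed, W mu^2 / 2 would be so large that [B2], which counts W mu^2 in full, and
   [Bu] would contradict [key]. *)
rewrite leNgt; apply/negP => fail.
have i0 : 0 < be^-1 by rewrite invr_gt0.
have bb : be^-1 * be = 1 by rewrite mulVf ?gt_eqF.
have mua : mu <= be^-1 * a by rewrite ler_pdivlMl.
have Mmu : M * mu * (t - 1) <= be^-1 * (M * a * (t - 1)).
  have -> : be^-1 * (M * a * (t - 1)) = M * (be^-1 * a) * (t - 1) by ring.
  by rewrite ler_wpM2r ?ler_wpM2l //; lra.
have Yl : be^-1 * b ^+ 2 <= l^-1 * b ^+ 2.
  by rewrite ler_wpM2r ?sqr_ge0 // lef_pV2.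
have La : F * a ^+ 2 <= L * a ^+ 2 by rewrite ler_wpM2r ?sqr_ge0.
rewrite -(ler_pM2l i0) in key.
have kE : be^-1 * ((1 - F * be) * a ^+ 2 + F * be * D + 4 * M * a * (t - 1))
  = be^-1 * a ^+ 2 - (be^-1 * be) * (F * a ^+ 2) + (be^-1 * be) * (F * D)
    + 4 * (be^-1 * (M * a * (t - 1))) by ring.
have kE' : be^-1 * (b ^+ 2 + 2 * (F * be) * t * (q ^+ 2 + 2 * M ^+ 2))
  = be^-1 * b ^+ 2 + (be^-1 * be) * (2 * F * t * (q ^+ 2 + 2 * M ^+ 2)) by ring.
rewrite kE kE' bb !mul1r in key.
move: wa B1 B2 Bu fail; rewrite expr0n /=; lra.
Qed.
End Scalar.

(** * Assembly of the estimates along the iterates *)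

Unset Implicit Arguments. Set Strict Implicit.

Theorem theorem2 (R : realType) (n : nat)
  (f h : 'rV[R]_n -> R) (gf gh : 'rV[R]_n -> 'rV[R]_n) (X : 'rV[R]_n -> \bar R)
  (Lf Lh LPsi M : R) (P : 'rV[R]_n -> 'rV[R]_n -> R -> 'rV[R]_n)
  (x0 xstar : 'rV[R]_n) (alpha beta lambda : nat -> R)
  (xs xmd xag : nat -> 'rV[R]_n) :
  (* smoothness of f (possibly nonconvex) and h (convex) *)
  is_gradient f gf -> 0 <= Lf -> lipschitz_map Lf gf ->
  convex_fun h -> is_gradient h gh -> 0 <= Lh -> lipschitz_map Lh gh ->
  LPsi = Lf + Lh ->
  (* the nonsmooth part X *)
  proper_fun X -> econvex_fun X -> closed_fun X -> bounded_dom X ->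
  (* the prox-mapping and its uniform bound *)
  is_prox X P ->
  (forall (c : R) x y, 0 < c -> enorm (P x y c) <= M) ->
  (* parameters *)
  alpha 1%N = 1 -> (forall k, (2 <= k)%N -> 0 < alpha k < 1) ->
  (forall k, (1 <= k)%N -> 0 < beta k) ->
  (forall k, (1 <= k)%N -> 0 < lambda k) ->
  (forall k, (1 <= k)%N -> alpha k * lambda k <= beta k /\ LPsi * beta k < 1) ->
  (forall k, (1 <= k)%N ->
     alpha k.+1 / (lambda k.+1 * Gamma alpha k.+1) <= alpha k / (lambda k * Gamma alpha k)) ->
  (* the composite AG iterates, with grad Psi = gf + gh *)
  xs 0%N = x0 -> xag 0%N = x0 ->
  (forall k, (1 <= k)%N ->
     [/\ xmd k = (1 - alpha k) *: xag k.-1 + alpha k *: xs k.-1,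
         xs k = P (xs k.-1) (gf (xmd k) + gh (xmd k)) (lambda k) &
         xag k = P (xmd k) (gf (xmd k) + gh (xmd k)) (beta k)]) ->
  (* x* is an optimal solution of min Phi, Phi = f + h + X *)
  (forall x, (((f xstar + h xstar)%:E + X xstar) <= ((f x + h x)%:E + X x))%E) ->
  forall N : nat, (1 <= N)%N ->
    \big[Num.min/ enorm (grad_map P (xmd 1%N) (gf (xmd 1%N) + gh (xmd 1%N)) (beta 1%N)) ^+ 2]_(1 <= k < N.+1)
        enorm (grad_map P (xmd k) (gf (xmd k) + gh (xmd k)) (beta k)) ^+ 2
      <= 2 * (\sum_(1 <= k < N.+1) (Gamma alpha k)^-1 * beta k * (1 - LPsi * beta k))^-1
           * (enorm (x0 - xstar) ^+ 2 / (2 * lambda 1%N)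
              + Lf / Gamma alpha N * (enorm xstar ^+ 2 + 2 * M ^+ 2))
    /\
    (Lf = 0 ->
      (((f (xag N) + h (xag N))%:E + X (xag N)) - ((f xstar + h xstar)%:E + X xstar)
        <= (Gamma alpha N * enorm (x0 - xstar) ^+ 2 / (2 * lambda 1%N))%:E)%E).
Proof.
move=> fg Lf0 gfL hc hg Lh0 ghL -> Xp Xc _ _ Pp PM a1 al be la par cd xs0 xag0
  iter opt [//|N] _.
pose L := Lf + Lh; rewrite -/L in par *.
have L0 : 0 <= L by rewrite addr_ge0.
have G0 k : 0 < Gamma alpha k by exact: Gamma_gt0.
have finS := optimal_fin Xp opt.
have [_ Lb1] := par 1%N isT; have b1 := be 1%N isT; have l1 := la 1%N isT.
have l1b : lambda 1%N <= beta 1%N by have [] := par 1%N isT; rewrite a1 mul1r.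
have xsM : enorm xstar <= M.
  have <- := prox_optimal fg Lf0 gfL hg Lh0 ghL Xp Xc Pp opt b1 Lb1.
  exact: PM.
have xagP k : X (xag k.+1) \is a fin_num /\ enorm (xag k.+1) <= M.
  by have [_ _ ->] := iter k.+1 isT; split; [apply: (prox_fin Xp Pp)|apply: PM];
    exact: be.
have xsP k : enorm (xs k.+1) <= M.
  by have [_ -> _] := iter k.+1 isT; apply: PM; exact: la.
pose delta k := composite f h X (xag k) - composite f h X xstar.
pose rho k := enorm (xs k - xstar) ^+ 2.
pose e k := enorm (xag k - xmd k).
pose w k := enorm ((1 - alpha k) *: xag k.-1 + alpha k *: xs k - xag k).
pose T k := ((beta k)^-1 - L) / 2 * e k ^+ 2 + (beta k)^-1 / 2 * w k ^+ 2.
pose K := Lf * (enorm xstar ^+ 2 + M ^+ 2).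
have delta_ge0 k : 0 <= delta k.+1.
  by rewrite subr_ge0; apply: (optimal_composite Xp opt); case: (xagP k).
have T_ge0 k : (1 <= k)%N -> 0 <= T k.
  move=> k1; have [_ Lbk] := par k k1; have bk := be k k1.
  have ib : 0 < (beta k)^-1 by rewrite invr_gt0.
  have iL : 0 <= (beta k)^-1 - L by rewrite subr_ge0 -div1r ler_pdivlMr // ltW.
  by rewrite addr_ge0 // mulr_ge0 ?sqr_ge0 // divr_ge0 // ltW.
(* Starts at k = 1, since [X] may be infinite at [x0]. *)
have step k : (1 <= k)%N -> delta k.+1 + T k.+1 <=
    (1 - alpha k.+1) * delta k
    + alpha k.+1 * ((lambda k.+1)^-1 / 2) * (rho k - rho k.+1)
    + alpha k.+1 * K.
  case: k => [//|k] _; have [mE xE pE] := iter k.+2 isT.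
  have [alb _] := par k.+2 isT; have [fa xaM] := xagP k.
  have := later_step fg Lf0 gfL hc hg Lh0 ghL Xp Xc Pp opt mE (erefl _)
    pE xE (al k.+2 isT) (la k.+2 isT) (be k.+2 isT) alb fa xaM (xsP k).
  by rewrite /T /delta /rho /K /e /w /L addrA.
have xmd1 : xmd 1%N = x0.
  have [-> _ _] := iter 1%N isT.
  by rewrite a1 /= xs0 xag0 subrr scale0r scale1r add0r.
have [_ xs1 xag1] := iter 1%N isT; rewrite /= xmd1 xs0 in xs1 xag1.
pose a := enorm (xag 1%N - x0); pose b := enorm (x0 - xstar).
pose p := enorm (xag 1%N - xstar).
have start : delta 1%N + ((beta 1%N)^-1 - L) / 2 * a ^+ 2
    + (lambda 1%N)^-1 / 2 * rho 1%N
    <= (lambda 1%N)^-1 / 2 * b ^+ 2 + Lf / 2 * (p * (a + b) - a ^+ 2).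
  exact: (first_step fg Lf0 gfL hc hg Lh0 ghL Xp Xc Pp opt (erefl _) xag1 xs1).
have sumT tau : (forall k, (1 <= k <= N)%N -> Gamma alpha k.+1 * tau k.+1 <= T k.+1) ->
    delta N.+1 / Gamma alpha N.+1 + \sum_(2 <= k < N.+2) tau k
    <= delta 1%N + (lambda 1%N)^-1 / 2 * rho 1%N
       + K * ((Gamma alpha N.+1)^-1 - 1).
  move=> tauT; apply: telescope_bound => // [k|k kN]; first exact: sqr_ge0.
  have [k1 _] := andP kN.
  by apply: le_trans (step k k1); rewrite lerD2l tauT.
(* For Lf = 0 both [K] and the first-step error vanish, and tau = 0 suffices. *)
split; last first.
  move=> Lf00; have [fN _] := xagP N.
  have := sumT (fun=> 0); rewrite big1 // addr0 => /(_ _)/wrap[|sum0].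
    by move=> k /andP[k1 _]; rewrite mulr0 T_ge0.
  have a0 : 0 <= ((beta 1%N)^-1 - L) / 2 * a ^+ 2.
    have ib : 0 < (beta 1%N)^-1 by rewrite invr_gt0.
    rewrite mulr_ge0 ?sqr_ge0 // divr_ge0 //.
    by rewrite subr_ge0 -div1r ler_pdivlMr // ltW.
  rewrite -(fineK fN) -(fineK finS) -!EFinD lee_fin.
  rewrite -/(composite _ _ _ _) -/(composite f h X xstar) -/(delta N.+1) -/b.
  have : delta N.+1 / Gamma alpha N.+1 <= (lambda 1%N)^-1 / 2 * b ^+ 2.
    by move: sum0 start; rewrite /K Lf00 !mul0r; lra.
  rewrite ler_pdivrMr // => /le_trans; apply.
  by rewrite invfM [leRHS]mulrC; lra.
(* The default value of the minimum is its own k = 1 term, hence harmless. *)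
set m := \big[_/_]_(_ <= _ < _) _.
have m0 : 0 <= m by apply: le_bigmin => [|k _]; exact: sqr_ge0.
pose mu := Num.sqrt m.
have mu0 : 0 <= mu by exact: sqrtr_ge0.
have mE : m = mu ^+ 2 by rewrite sqr_sqrtr.
have bmu k : (1 <= k <= N.+1)%N -> beta k * mu <= e k.
  move=> /andP[k1 kN]; have bk := be k k1.
  rewrite -ler_pdivlMl //.
  have -> : (beta k)^-1 * e k
      = enorm (grad_map P (xmd k) (gf (xmd k) + gh (xmd k)) (beta k)).
    have [_ _ pE] := iter k k1.
    by rewrite /grad_map -pE enormZ gtr0_norm ?invr_gt0 // enormBC.
  rewrite -(@ler_pXn2r _ 2) ?nnegrE ?enorm_ge0 // -mE.
  apply: (@bigmin_inf_seq _ _ _ _ _ k) => //.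
  by rewrite mem_index_iota k1 ltnS.
pose om k := beta k * (1 - L * beta k).
(* Here s = 2 M alpha_k: u_k - x^md_k = alpha_k (x_k - x_(k-1)), and for k >= 2 both points lie in
   the ball of radius M. *)
have waste k : (2 <= k <= N.+1)%N ->
    om k * mu ^+ 2 / 2 <= T k /\
    om k * mu ^+ 2 - alpha k * (2 * M) * mu <= T k.
  case: k => [|[|k]] // /andP[_ kN]; have [_ Lbk] := par k.+2 isT.
  have M0 := le_trans (enorm_ge0 _) xsM.
  have /andP[ak _] := al k.+2 isT.
  apply: waste_bound => //; [exact: be | exact: bmu | |].
    by rewrite !mulr_ge0 // ltW.
  have [xmE _ _] := iter k.+2 isT.
  rewrite /e enormBC.
  have -> : xmd k.+2 - xag k.+2 =
     ((1 - alpha k.+2) *: xag k.+1 + alpha k.+2 *: xs k.+2 - xag k.+2)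
     - alpha k.+2 *: (xs k.+2 - xs k.+1).
    by rewrite xmE; apply/rowP => i; rewrite !mxE; ring.
  apply: le_trans (ler_enormB _ _) _; rewrite lerD2l enormZ gtr0_norm //.
  rewrite ler_pM2l //; apply: le_trans (ler_enormB _ _) _.
  by have := xsP k; have := xsP k.+1; lra.
pose W := \sum_(2 <= k < N.+2) om k / Gamma alpha k.
pose t := (Gamma alpha N.+1)^-1.
have sE : \sum_(1 <= k < N.+2) (Gamma alpha k)^-1 * beta k * (1 - L * beta k)
    = W + beta 1%N * (1 - L * beta 1%N).
  rewrite big_nat_recl // [RHS]addrC /= invr1 mul1r; congr (_ + _).
  by rewrite /W [RHS]big_add1 /=; apply: eq_bigr => k _; rewrite /om; ring.
have om_gt0 k : (1 <= k)%N -> 0 < om k.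
  move=> k1; have [_ Lbk] := par k k1; rewrite mulr_gt0 ?be //; lra.
have W0 : 0 <= W.
  rewrite /W big_nat_cond; apply: sumr_ge0 => k /andP[/andP[k2 _] _].
  by rewrite divr_ge0 // ltW // om_gt0 // ltnW.
have s0 : 0 < W + beta 1%N * (1 - L * beta 1%N).
  by rewrite ltr_wpDl // (om_gt0 1%N).
(* Two choices of [tau]: half weights without loss, and full weights with a loss that
   [sum_alpha_Gamma] sums. *)
have B1 := sumT (fun k => om k / Gamma alpha k * mu ^+ 2 / 2).
have B2 := sumT (fun k => om k / Gamma alpha k * mu ^+ 2
                          - alpha k / Gamma alpha k * (2 * M) * mu).
have {}B1 : W * mu ^+ 2 / 2 <= delta 1%N + (lambda 1%N)^-1 / 2 * rho 1%N
       + K * (t - 1).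
  rewrite /W !big_distrl /=.
  apply: le_trans (B1 _); first by rewrite ler_wpDl // divr_ge0 // ltW.
  move=> k kN; have [le _] := waste k.+1 kN; apply: le_trans le.
  by rewrite le_eqVlt; apply/orP; left; apply/eqP; field; rewrite gt_eqF.
have {}B2 : W * mu ^+ 2 - 2 * M * mu * (t - 1)
    <= delta 1%N + (lambda 1%N)^-1 / 2 * rho 1%N + K * (t - 1).
  rewrite /W /t -sum_alpha_Gamma // big_distrl mulr_sumr -sumrB /=.
  rewrite sum_alpha_Gamma // -/t; apply: le_trans (B2 _).
    rewrite ler_wpDl ?divr_ge0 ?(ltW (G0 _)) //.
    by apply: ler_sum => k _; rewrite le_eqVlt; apply/orP; left; apply/eqP; ring.
  move=> k kN; have [_ le] := waste k.+1 kN; apply: le_trans le.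
  by rewrite le_eqVlt; apply/orP; left; apply/eqP; field; rewrite gt_eqF.
have t1 : 1 <= t.
  rewrite -subr_ge0 /t -sum_alpha_Gamma //; rewrite big_nat_cond; apply: sumr_ge0 => k /andP[/andP[k2 _] _].
  by rewrite divr_ge0 ?(ltW (G0 _)) //; case/andP: (al k k2) => /ltW.
have ab : b <= a + p.
  rewrite /a /p [X in X + _]enormBC /b.
  have -> : x0 - xstar = (x0 - xag 1%N) + (xag 1%N - xstar).
    by rewrite addrA subrK.
  exact: ler_enormD.
have pqM : p <= enorm xstar + M.
  by rewrite addrC; apply: le_trans (ler_enormB _ _) _; rewrite lerD2r; case: (xagP 0%N).
have mua : beta 1%N * mu <= a by have := bmu 1%N isT; rewrite /e xmd1.
have FL : Lf <= L by rewrite lerDl.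
(* [B] is the right side common to [B1] and [B2]; the premise left open follows from [start]. *)
have /(_ _)/wrap[|] := combine_bounds Lf0 FL l1 l1b Lb1 (enorm_ge0 xstar) xsM
  (enorm_ge0 _) pqM (enorm_ge0 _) (enorm_ge0 _) ab t1 mu0 mua B1 B2.
  move: start; rewrite -/a -/b -/p /K. lra.
rewrite sE -/b -/t -mE => fin.
by rewrite mulrAC ler_pdivlMr // invfM; move: fin; lra.
Qed.
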